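(* Let $(M,Q)$ be a Q-manifold, let $X\in\mathrm{Vect}(M)$ be an odd infinitesimal symmetry (an odd vector field with $[Q,X]=0$), and let $\tau$ be a derived cyclic $0$-cocycle of $(M,Q)$. Let $\phi$ be the derived cyclic $1$-cocycle $$\phi(f_0,f_1):=\tau\big((-1)^{\widetilde f_0}X(f_0f_1)\big).$$ Then an infinitesimally deformed derived cyclic $0$-cocycle $\tau_{(t)}=\tau+t\,\sigma$, with $\sigma\in C^0_\lambda(M,Q)$, exists if and only if the derived cyclic class $[\phi]\in HC^1_\lambda(M,Q)$ is zero.
   Context: Supermanifolds are real smooth supermanifolds in the sense of Berezin--Leites; $C^\infty(M)$ is the supercommutative nuclear Fréchet algebra of global sections of the structure sheaf, and $\widetilde f\in\mathbb Z_2$ is the Grassmann parity of a homogeneous $f$. A Q-manifold $(M,Q)$ is a supermanifold with an odd vector field $Q$ satisfying $[Q,Q]=0$ (equivalently $Q^2=0$). Derived product: $f\star g := (-1)^{\widetilde f}Q(f)g$ (for homogeneous $f$, extended bilinearly), which is associative. Shifted parity: $\overline f:=\widetilde f+1$. $n$-cochains: $C^n(M,Q)$ is the super vector space of all (even and odd) continuous $\mathbb R$-linear maps $\phi^n: C^\infty(M)^{\widehat\otimes (n+1)}\to\mathbb R$ (completed projective tensor product), written $\phi^n(f_0,\dots,f_n)$. Shifted cyclic operator: $(\lambda\phi^n)(f_0,\dots,f_n):=(-1)^{n+\overline f_n(\overline f_0+\cdots+\overline f_{n-1})}\phi^n(f_n,f_0,\dots,f_{n-1})$. Derived cyclic cochains: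 $C^n_\lambda(M,Q)=\{\phi^n:\lambda\phi^n=\phi^n\}$. Hochschild coboundary: $$(b\phi^n)(f_0,\dots,f_{n+1})=\sum_{i=0}^n(-1)^i\phi^n(f_0,\dots,f_i\star f_{i+1},\dots,f_{n+1})+(-1)^{n+1+\overline f_{n+1}(\overline f_0+\cdots+\overline f_n)}\phi^n(f_{n+1}\star f_0,f_1,\dots,f_n).$$ One has $b^2=0$ and $b(C^n_\lambda)\subset C^{n+1}_\lambda$. $HC^n_\lambda(M,Q)$ is the cohomology of $(C^\bullet_\lambda(M,Q),b)$; a derived cyclic $n$-cocycle is a $b$-closed element of $C^n_\lambda(M,Q)$, and $[\phi^n]$ is its class. Infinitesimal deformation: with $t$ an even parameter and all terms $O(t^2)$ dropped, $Q_{(t)}:=Q+tX$ satisfies $Q_{(t)}^2=0$ to first order; the deformed product is $f\star_{(t)}g=f\star g+(-1)^{\widetilde f}t\,X(f)g$, and $b_{(t)}$ is the Hochschild coboundary defined with $\star_{(t)}$ in place of $\star$, i.e. $$(b_{(t)}\phi^n)(f_0,\dots,f_{n+1})=\sum_{i=0}^n(-1)^i\phi^n(f_0,\dots,f_i\star_{(t)} f_{i+1},\dots,f_{n+1})+(-1)^{n+1+\overline f_{n+1}(\overline f_0+\cdots+\overline f_n)}\phi^n(f_{n+1}\star_{(t)} f_0,f_1,\dots,f_n).$$ $\tau_{(t)}=\tau+t\sigma$ is an infinitesimally deformed derived cyclic $0$-cocycle if $b_{(t)}\tau_{(t)}=0$ to first order in $t$ (i.e. modulo $t^2$). *)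

(* Defs.v *)
From HB Require Import structures.
From mathcomp Require Import all_boot all_order all_algebra.
From mathcomp Require Import all_classical all_reals all_analysis.

Set Implicit Arguments.
Unset Strict Implicit.
Unset Printing Implicit Defensive.

Import Order.TTheory GRing.Theory Num.Theory.
Import numFieldNormedType.Exports.
Local Open Scope classical_set_scope.
Local Open Scope ring_scope.

(* Associative, unital and supercommutative; the zero algebra is allowed, since it is
   the algebra of sections over the empty set.  The Z/2-grading is given by its two
   projections: [part e f] is the component of f of parity e (false = even,
   true = odd). *)
HB.mixin Record isSuperAlgebra (R : pzRingType) A of GRing.Lmodule R A := {
  smul : A -> A -> A;
  sone : A;
  part : bool -> A -> A;
  smul_linearl : forall g, linear (fun f => smul f g);
  smul_linearr : forall f, linear (smul f);
  smulA : associative smul;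
  smul1l : left_id sone smul;
  smul1r : right_id sone smul;
  part_linear : forall e, linear (part e);
  part_part : forall d e (f : A), part d (part e f) = if d == e then part e f else 0;
  part_sum : forall f : A, part false f + part true f = f;
  part_one : part false sone = sone;
  part_smul : forall d e (f g : A), part d f = f -> part e g = g ->
    part (d (+) e) (smul f g) = smul f g;
  supercomm : forall d e (f g : A), part d f = f -> part e g = g ->
    smul f g = (-1) ^+ (d && e) *: smul g f
}.

#[short(type="superAlgType")]
HB.structure Definition SuperAlgebra (R : pzRingType) :=
  {A of isSuperAlgebra R A & GRing.Lmodule R A}.

Notation "f ** g" := (smul f g) (at level 40, left associativity) : ring_scope.

Definition homogeneous (R : pzRingType) (A : superAlgType R) (e : bool) (f : A) :=
  part e f = f.

Definition salg_morphism (R : pzRingType) (A B : superAlgType R) (u : A -> B) :=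
  [/\ linear u, u sone = sone, {morph u : f g / f ** g} &
      forall e f, u (part e f) = part e (u f)].

Fixpoint Ck (R : realType) (p k : nat) (V : set 'rV[R]_p) (f : 'rV[R]_p -> R^o) : Prop :=
  (forall y, V y -> {for y, continuous f}) /\
  if k is k'.+1 then
    forall i : 'I_p, (forall y, V y -> derivable f y (delta_mx 0 i)) /\
      Ck k' V (fun y => 'D_(delta_mx 0 i) f y)
  else True.

Definition smooth_on (R : realType) (p : nat) (V : set 'rV[R]_p) (f : 'rV[R]_p -> R^o) :=
  forall k, Ck k V f.

(* The Grassmann algebra on q generators xi_0, ..., xi_(q-1); the coefficient at
   S is that of the monomial xi_S, with the generators in increasing order. *)
Definition grassmann (R : realType) (q : nat) := {ffun {set 'I_q} -> R}.

Definition grassmann_one (R : realType) (q : nat) : grassmann R q :=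
  [ffun S => (S == finset.set0)%:R].

(* xi_S xi_T = (-1)^(number of inversions) xi_(S u T) for disjoint S, T *)
Definition inversions (q : nat) (S T : {set 'I_q}) : nat :=
  #|[set ij : 'I_q * 'I_q | [&& ij.1 \in S, ij.2 \in T & (ij.2 < ij.1)%N]]%SET|.

Definition grassmann_mul (R : realType) (q : nat) (a b : grassmann R q) : grassmann R q :=
  [ffun S : {set 'I_q} => \sum_(T : {set 'I_q} | T \subset S)
     (-1) ^+ inversions T (S :\: T) * a T * b (S :\: T)%SET].

Record opens (M : topologicalType) := Opens { oset :> set M; open_oset : open oset }.

Definition opensT (M : topologicalType) : opens M := Opens (@openT M).

Record superspace (R : realType) := Superspace {
  space : topologicalType;
  sections : opens space -> superAlgType R;
  restr : forall U V : opens space, V `<=` U -> sections U -> sections V;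
  restr_morphism : forall (U V : opens space) (h : V `<=` U), salg_morphism (restr h);
  restr_id : forall (U : opens space) (h : U `<=` U) f, restr h f = f;
  restr_comp : forall (U V W : opens space) (hUV : V `<=` U) (hVW : W `<=` V) (hUW : W `<=` U) f,
    restr hVW (restr hUV f) = restr hUW f;
  sheaf_separated : forall (U : opens space) (F : set (opens space)),
    U = \bigcup_(V in F) V :> set space ->
    forall f g : sections U,
      (forall (V : opens space) (h : V `<=` U), F V -> restr h f = restr h g) -> f = g;
  sheaf_gluing : forall (U : opens space) (F : set (opens space)),
    U = \bigcup_(V in F) V :> set space ->
    forall s : (forall V, sections V),
      (forall (V1 V2 W : opens space) (h1 : W `<=` V1) (h2 : W `<=` V2), F V1 -> F V2 ->
         restr h1 (s V1) = restr h2 (s V2)) ->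
      exists f : sections U, forall (V : opens space) (h : V `<=` U), F V -> restr h f = s V;
  (* the real-valued function on U underlying a section; on a supermanifold it is
     determined by the sheaf, through the charts (see [loc_reduced] below) *)
  reduced : forall U : opens space, sections U -> space -> R;
  reduced_restr : forall (U V : opens space) (h : V `<=` U) (f : sections U) x,
    oset V x -> reduced (restr h f) x = reduced f x
}.

(* A superchart: a homeomorphism from an open set of M to an open set of R^p with
   an isomorphism, over it, from the sheaf of M to the sheaf
   C^oo(.) (x) Lambda(xi_0, ..., xi_(q-1)).  A section of the latter over V is a
   function 'rV_p -> grassmann R q with coefficients smooth on V, of which only the
   values on V matter; [loc W f] represents f restricted to W. *)
Record superchart (R : realType) (M : superspace R) (p q : nat) := Superchart {
  cdom : opens (space M);
  ctgt : set 'rV[R]_p;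
  cmap : space M -> 'rV[R]_p;
  cinv : 'rV[R]_p -> space M;
  ctgt_open : open ctgt;
  cmapK : forall x, oset cdom x -> ctgt (cmap x) /\ cinv (cmap x) = x;
  cinvK : forall y, ctgt y -> oset cdom (cinv y) /\ cmap (cinv y) = y;
  cmap_continuous : forall x, oset cdom x -> {for x, continuous cmap};
  cinv_continuous : forall y, ctgt y -> {for y, continuous cinv};
  loc : forall W : opens (space M), sections W -> 'rV[R]_p -> grassmann R q;
  loc_smooth : forall W : opens (space M), W `<=` cdom ->
    forall (f : sections W) S, smooth_on (ctgt `&` cinv @^-1` W) (fun y => loc f y S);
  loc_inj : forall W : opens (space M), W `<=` cdom ->
    forall f g : sections W, (forall y, (ctgt `&` cinv @^-1` W) y -> loc f y = loc g y) -> f = g;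
  loc_surj : forall W : opens (space M), W `<=` cdom ->
    forall s : 'rV[R]_p -> grassmann R q,
      (forall S, smooth_on (ctgt `&` cinv @^-1` W) (fun y => s y S)) ->
      exists f : sections W, forall y, (ctgt `&` cinv @^-1` W) y -> loc f y = s y;
  loc_linear : forall W : opens (space M), W `<=` cdom ->
    forall a (f g : sections W) y S, (ctgt `&` cinv @^-1` W) y ->
      loc (a *: f + g) y S = a * loc f y S + loc g y S;
  loc_one : forall W : opens (space M), W `<=` cdom ->
    forall y, (ctgt `&` cinv @^-1` W) y -> loc (sone : sections W) y = grassmann_one R q;
  loc_mul : forall W : opens (space M), W `<=` cdom ->
    forall (f g : sections W) y, (ctgt `&` cinv @^-1` W) y ->
      loc (f ** g) y = grassmann_mul (loc f y) (loc g y);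
  loc_part : forall W : opens (space M), W `<=` cdom ->
    forall e (f : sections W) y S, (ctgt `&` cinv @^-1` W) y ->
      loc (part e f) y S = if odd #|S| == e then loc f y S else 0;
  loc_restr : forall (W W' : opens (space M)) (h : W' `<=` W), W `<=` cdom ->
    forall (f : sections W) y, (ctgt `&` cinv @^-1` W') y -> loc (restr h f) y = loc f y;
  loc_reduced : forall W : opens (space M), W `<=` cdom ->
    forall (f : sections W) x, oset W x -> reduced f x = loc f (cmap x) finset.set0
}.

Record supermanifold (R : realType) := Supermanifold {
  sspace :> superspace R;
  dim_even : nat;
  dim_odd : nat;
  sm_hausdorff : hausdorff_space (space sspace);
  sm_second_countable : @second_countable (space sspace);
  sm_locally_model : forall x : space sspace,
    exists c : superchart sspace dim_even dim_odd, oset (cdom c) x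
}.

Definition Cinfty (R : realType) (M : supermanifold R) : Type :=
  sections (opensT (space M)).

HB.instance Definition _ (R : realType) (M : supermanifold R) :=
  SuperAlgebra.on (Cinfty M).

Section Geometry.
Variables (R : realType) (M : supermanifold R).
Local Notation A := (Cinfty M).

Definition vector_field (e : bool) (X : A -> A) : Prop :=
  [/\ linear X,
      forall d f, homogeneous d f -> homogeneous (e (+) d) (X f) &
      forall d f g, homogeneous d f ->
        X (f ** g) = X f ** g + (-1) ^+ (e && d) *: (f ** X g)].

Definition supercommutator (d e : bool) (X Y : A -> A) : A -> A :=
  fun f => X (Y f) - (-1) ^+ (d && e) *: Y (X f).

(* differential operators: the algebra generated by functions and vector fields *)
Inductive diffop : (A -> A) -> Prop :=
| diffop_mul (h : A) : diffop (fun f => h ** f)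
| diffop_vf e X : vector_field e X -> diffop X
| diffop_add D E : diffop D -> diffop E -> diffop (fun f => D f + E f)
| diffop_comp D E : diffop D -> diffop E -> diffop (fun f => D (E f)).

Definition reductions (f : A) :
    prod_topology (fun _ : {D : A -> A | diffop D} => {family compact, space M -> R}) :=
  fun D => reduced (sval D f).

(* The Frechet topology of C^oo(M): the coarsest one for which, for every
   differential operator D, the map sending f to the reduced function of D f is
   continuous for uniform convergence on compact sets; that is, the topology of the
   seminorms f |-> sup_K |reduced (D f)|, K compact. *)
HB.instance Definition _ := Topological.copy A (initial_topology reductions).

End Geometry.

Record qManifold (R : realType) := QManifold {
  qspace :> supermanifold R;
  Qfield : Cinfty qspace -> Cinfty qspace;
  Qfield_odd : vector_field true Qfield;
  Qfield_homological : supercommutator true true Qfield Qfield = 0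
}.

Definition odd_symmetry (R : realType) (M : qManifold R)
    (X : Cinfty M -> Cinfty M) : Prop :=
  vector_field true X /\ supercommutator true true (@Qfield R M) X = 0.

Section Cochains.
Variables (R : realType) (M : supermanifold R).
Local Notation A := (Cinfty M).

(* (f, g) |-> (-1)^f D(f) g for homogeneous f, extended bilinearly *)
Definition derived_product (D : A -> A) (f g : A) : A :=
  \sum_(e : bool) (-1) ^+ e *: (D (part e f) ** g).

(* Continuous linear functionals on the completed projective tensor power
   A^((x)(n+1)) are the same as continuous (n+1)-linear functionals on A. *)
Definition is_cochain (n : nat) (phi : ('I_n.+1 -> A) -> R^o) : Prop :=
  (forall (f : 'I_n.+1 -> A) i (a : R) (u v : A),
     phi (dfwith f i (a *: u + v)) = a * phi (dfwith f i u) + phi (dfwith f i v)) /\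
  continuous (phi : prod_topology (fun _ : 'I_n.+1 => A) -> R^o).

(* the component of (f_0, ..., f_n) with parities (p_0, ..., p_n); a formula stated
   for homogeneous arguments is extended multilinearly by summing over all p *)
Definition parts (n : nat) (p : {ffun 'I_n -> bool}) (f : 'I_n -> A) : 'I_n -> A :=
  fun i => part (p i) (f i).

(* bar f_n * (bar f_0 + ... + bar f_(n-1)), where bar f_i = p_i + 1 *)
Definition cyclic_exponent (n : nat) (p : {ffun 'I_n.+1 -> bool}) : nat :=
  ~~ p ord_max * \sum_(i < n.+1 | i != ord_max) ~~ p i.

(* [ord_pred] is j |-> j - 1 mod n + 1, so this evaluates phi at
   (f_n, f_0, ..., f_(n-1)) *)
Definition lam (n : nat) (phi : ('I_n.+1 -> A) -> R^o) (f : 'I_n.+1 -> A) : R^o :=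
  \sum_(p : {ffun 'I_n.+1 -> bool})
    (-1) ^+ (n + cyclic_exponent p) *: phi (fun j => parts p f (ord_pred j)).

Definition is_cyclic_cochain (n : nat) (phi : ('I_n.+1 -> A) -> R^o) : Prop :=
  is_cochain phi /\ lam phi = phi.

(* The Hochschild coboundary for a product m on A with values in an extension B of
   A, along inj : A -> B, of a cochain on B with values in W.  The undeformed case is
   B = A, W = R; the deformed one has B = A[t]/(t^2), W = R[t]/(t^2). *)
Section Hochschild.
Variables (B : Type) (W : lmodType R) (m : A -> A -> B) (inj : A -> B) (n : nat).

Definition face (f : 'I_n.+2 -> A) (i : 'I_n.+1) : 'I_n.+1 -> B := fun j =>
  if (j < i)%N then inj (f (widen_ord (leqnSn _) j))
  else if j == i then m (f (widen_ord (leqnSn _) i)) (f (lift ord0 i))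
  else inj (f (lift ord0 j)).

Definition last_face (f : 'I_n.+2 -> A) : 'I_n.+1 -> B := fun j =>
  if j == ord0 then m (f ord_max) (f ord0) else inj (f (widen_ord (leqnSn _) j)).

Definition hochschild (phi : ('I_n.+1 -> B) -> W) (f : 'I_n.+2 -> A) : W :=
  \sum_(i < n.+1) (-1) ^+ i *: phi (face f i) +
  \sum_(p : {ffun 'I_n.+2 -> bool})
    (-1) ^+ (n.+1 + cyclic_exponent p) *: phi (last_face (parts p f)).

Lemma hochschildB (phi psi : ('I_n.+1 -> B) -> W) :
  hochschild (phi - psi) = hochschild phi - hochschild psi.
Proof.
apply/funext => f; rewrite -[RHS]/(hochschild phi f - hochschild psi f) /hochschild.
rewrite opprD addrACA -!sumrB.
by congr (_ + _); apply: eq_bigr => i _; rewrite -scalerBr.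
Qed.

End Hochschild.

Lemma is_cyclic_cochain0 n : @is_cyclic_cochain n 0.
Proof.
split; [split|].
- by move=> f i a u v; rewrite -[LHS]/0 -[RHS]/(a * 0 + 0) mulr0 addr0.
- by move=> f; exact: (@cst_continuous _ _ (0 : R^o)).
- by apply/funext => f; rewrite /lam big1// => p _; rewrite scaler0.
Qed.

Lemma is_cyclic_cochainB n (phi psi : ('I_n.+1 -> A) -> R^o) :
  is_cyclic_cochain phi -> is_cyclic_cochain psi -> is_cyclic_cochain (phi - psi).
Proof.
move=> [[lphi cphi] ephi] [[lpsi cpsi] epsi]; split; [split|].
- move=> f i a u v.
  by rewrite -[LHS]/(phi _ - psi _) lphi lpsi opprD addrACA -mulrBr.
- by move=> f; exact: (@cvgB R R^o _ (nbhs f) _ phi psi _ _ (cphi f) (cpsi f)).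
- apply/funext => f; rewrite -[in RHS]ephi -[in RHS]epsi.
  rewrite -[RHS]/(lam phi f - lam psi f) /lam -sumrB.
  by apply: eq_bigr => p _; rewrite -scalerBr.
Qed.

End Cochains.

Section Cohomology.
Variables (R : realType) (M : qManifold R).
Local Notation A := (Cinfty M).

Definition coboundary (n : nat) (phi : ('I_n.+1 -> A) -> R^o) :
    ('I_n.+2 -> A) -> R^o :=
  hochschild (derived_product (@Qfield R M)) id phi.

Definition cyclic_cocycle (n : nat) : {pred ('I_n.+1 -> A) -> R^o} :=
  fun phi => `[< is_cyclic_cochain phi /\ coboundary phi = 0 >].

Lemma cyclic_cocycle_zmod n : zmod_closed (@cyclic_cocycle n).
Proof.
split=> [|phi psi /asboolP[cphi zphi] /asboolP[cpsi zpsi]]; apply/asboolP; split.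
- exact: is_cyclic_cochain0.
- by rewrite -(subrr 0) /coboundary hochschildB subrr.
- exact: is_cyclic_cochainB.
- by rewrite /coboundary hochschildB -/(coboundary phi) zphi -/(coboundary psi) zpsi subrr.
Qed.

HB.instance Definition _ n :=
  GRing.isZmodClosed.Build (('I_n.+1 -> A) -> R^o) (@cyclic_cocycle n)
    (cyclic_cocycle_zmod n).

Definition cocycles (n : nat) := {phi : ('I_n.+1 -> A) -> R^o | phi \in @cyclic_cocycle n}.

HB.instance Definition _ n := SubChoice.on (cocycles n).
HB.instance Definition _ n := [SubChoice_isSubZmodule of cocycles n by <:].

(* the image of b in degree n (there are no cochains in degree -1) *)
Definition is_cyclic_coboundary (n : nat) : (('I_n.+1 -> A) -> R^o) -> Prop :=
  if n is k.+1 then fun phi => exists2 psi : ('I_k.+1 -> A) -> R^o,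
    is_cyclic_cochain psi & phi = coboundary psi
  else fun phi => phi = 0.

Definition cyclic_coboundary (n : nat) : {pred cocycles n} :=
  fun phi => `[< is_cyclic_coboundary (val phi) >].

Lemma cyclic_coboundary_zmod n : zmod_closed (@cyclic_coboundary n).
Proof.
split=> [|phi psi /asboolP cphi /asboolP cpsi]; apply/asboolP.
- case: n => [//|n]; exists 0; first exact: is_cyclic_cochain0.
  by rewrite -[X in coboundary X](subrr 0) /coboundary hochschildB subrr.
- case: n => [|n] in phi psi cphi cpsi *.
    by rewrite /= in cphi cpsi *; rewrite cphi cpsi subrr.
  have [f cf ef] := cphi; have [g cg eg] := cpsi.
  exists (f - g); first exact: is_cyclic_cochainB.
  by rewrite /coboundary hochschildB -/(coboundary f) -ef -/(coboundary g) -eg.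
Qed.

HB.instance Definition _ n :=
  GRing.isZmodClosed.Build (cocycles n) (@cyclic_coboundary n)
    (cyclic_coboundary_zmod n).

Definition HC (n : nat) : zmodType := Quotient.quot (@cyclic_coboundary n).

Definition HC_class (n : nat) (phi : ('I_n.+1 -> A) -> R^o)
    (hphi : phi \in @cyclic_cocycle n) : HC n :=
  (\pi_(Quotient.quot (@cyclic_coboundary n)) (exist _ phi hphi : cocycles n))%qT.

(* Elements a + t a' of V[t]/(t^2) are represented by pairs (a, a'). *)

(* the R[t]/(t^2)-multilinear extension of phi + t psi *)
Definition first_order_cochain (n : nat) (phi psi : ('I_n.+1 -> A) -> R^o)
    (F : 'I_n.+1 -> A * A) : R^o * R^o :=
  let f := fun i => (F i).1 in
  (phi f, psi f + \sum_(i < n.+1) phi (dfwith f i (F i).2)).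

Definition deformed_product (X : A -> A) (f g : A) : A * A :=
  (derived_product (@Qfield R M) f g, derived_product X f g).

(* b_(t) (phi + t psi) modulo t^2 *)
Definition deformed_coboundary (X : A -> A) (n : nat)
    (phi psi : ('I_n.+1 -> A) -> R^o) : ('I_n.+2 -> A) -> R^o * R^o :=
  hochschild (deformed_product X) (fun f => (f, 0)) (first_order_cochain phi psi).

(* phi(f_0, f_1) = tau((-1)^(f_0) X(f_0 f_1)) *)
Definition symmetry_cochain (X : A -> A) (tau : ('I_1 -> A) -> R^o)
    (f : 'I_2 -> A) : R^o :=
  tau (fun=> \sum_(e : bool) (-1) ^+ e *: X (part e (f ord0) ** f ord_max)).

End Cohomology.

(* Main.v *)
(* For an odd derivation [D] and a 0-cochain [sigma], the Leibniz rule collapses the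
   Hochschild coboundary for the derived product of [D] to
   (f0, f1) |-> sigma((-1)^f0 D(f0 f1)).  With D = Q this shows that tau is closed iff
   tau o Q = 0 (take f0 = 1), and with D = X that phi is the coboundary of tau for the
   product deformed by X alone.  Hence b_(t) (tau + t sigma) = b tau + t (b sigma + phi),
   which vanishes iff phi = b (- sigma).  That phi is closed follows from
   tau o X o Q = - tau o Q o X = 0.  That phi is continuous reduces to the joint
   continuity of the product of C^oo(M): by the Leibniz rule D (f g) is a sum of products
   of expressions continuous in f and in g, and [reduced] is multiplicative with values
   in continuous functions, which are bounded on compact sets. *)

Require Import Defs.
From HB Require Import structures.
From mathcomp Require Import all_boot all_order all_algebra.
From mathcomp Require Import all_classical all_reals all_analysis.
From mathcomp Require Import ring.

Set Implicit Arguments.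
Unset Strict Implicit.
Unset Printing Implicit Defensive.

Import Order.TTheory GRing.Theory Num.Theory.
Import numFieldNormedType.Exports.
Local Open Scope classical_set_scope.
Local Open Scope ring_scope.

(** * Unbundled linear maps and sums over parity assignments *)

Section LinearFunctions.
Variables (R : pzRingType) (U V : lmodType R) (X : U -> V).
Hypothesis Xl : linear X.

Lemma linear_morphD : {morph X : f g / f + g}.
Proof. by move=> f g; have := Xl 1 f g; rewrite !scale1r. Qed.

Lemma linear_morph0 : X 0 = 0.
Proof. by apply: (addrI (X 0)); rewrite -linear_morphD !addr0. Qed.

Lemma linear_morphZ a : {morph X : f / a *: f}.
Proof. by move=> f; have := Xl a f 0; rewrite linear_morph0 !addr0. Qed.

Lemma linear_morph_sum I (r : seq I) (P : pred I) F :
  X (\sum_(i <- r | P i) F i) = \sum_(i <- r | P i) X (F i).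
Proof. exact: (big_morph X linear_morphD linear_morph0). Qed.

End LinearFunctions.

(** Cyclic signs are summed over parity assignments, while bilinear expansions give iterated sums
    over parities; this puts both in the same shape. *)
Lemma sum_ffun2 (W : nmodType) (F : bool -> bool -> W) :
  \sum_(p : {ffun 'I_2 -> bool}) F (p ord0) (p ord_max) = \sum_a \sum_b F a b.
Proof.
rewrite pair_bigA /=.
rewrite (reindex (fun x : bool * bool => [ffun i : 'I_2 => nth false [:: x.1; x.2] i])) /=.
  by apply: eq_bigr => x _; rewrite !ffunE.
exists (fun p : {ffun 'I_2 -> bool} => (p ord0, p ord_max)) => [[a b] _|p _] /=.
  by rewrite !ffunE.
apply/ffunP => i; rewrite ffunE.
by case: i => -[|[|//]] lt_i /=; congr (p _); exact: val_inj.
Qed.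

Lemma sum_ffun3 (W : nmodType) (F : bool -> bool -> bool -> W) :
  \sum_(p : {ffun 'I_3 -> bool}) F (p ord0) (p (lift ord0 ord0)) (p ord_max) =
  \sum_a \sum_b \sum_c F a b c.
Proof.
under [RHS]eq_bigr => a _ do rewrite pair_bigA /=.
rewrite pair_bigA /=.
rewrite (reindex (fun x : bool * (bool * bool) =>
  [ffun i : 'I_3 => nth false [:: x.1; x.2.1; x.2.2] i])) /=.
  by apply: eq_bigr => x _; rewrite !ffunE.
exists (fun p : {ffun 'I_3 -> bool} => (p ord0, (p (lift ord0 ord0), p ord_max))).
  by move=> [a [b c]] _; rewrite /= !ffunE.
move=> p _; apply/ffunP => i; rewrite ffunE.
by case: i => -[|[|[|//]]] lt_i /=; congr (p _); exact: val_inj.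
Qed.

(** * Superalgebras and homogeneous elements *)

Section SuperAlgebraTheory.
Variables (R : pzRingType) (A : superAlgType R).
Implicit Types f g : A.

HB.instance Definition _ f :=
  GRing.isLinear.Build R A A *:%R (smul f) (smul_linearr f).
HB.instance Definition _ e :=
  GRing.isLinear.Build R A A *:%R (@part R A e) (@part_linear R A e).

Lemma smulDl f f' g : (f + f') ** g = f ** g + f' ** g.
Proof. by have := smul_linearl g 1 f f'; rewrite !scale1r. Qed.

Lemma smul0l g : (0 : A) ** g = 0.
Proof. by apply: (addrI ((0 : A) ** g)); rewrite -smulDl !addr0. Qed.

Lemma smulZl a f g : (a *: f) ** g = a *: (f ** g).
Proof. by have := smul_linearl g a f 0; rewrite smul0l !addr0. Qed.

Lemma smulZr a f g : f ** (a *: g) = a *: (f ** g).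
Proof. exact: linearZ. Qed.

Lemma smulDr f g g' : f ** (g + g') = f ** g + f ** g'.
Proof. exact: raddfD. Qed.

Lemma homogeneous_part e f : homogeneous e (part e f).
Proof. by rewrite /homogeneous part_part eqxx. Qed.

Lemma homogeneousD e f g :
  homogeneous e f -> homogeneous e g -> homogeneous e (f + g).
Proof. by rewrite /homogeneous raddfD /= => -> ->. Qed.

Lemma homogeneousZ e a f : homogeneous e f -> homogeneous e (a *: f).
Proof. by rewrite /homogeneous linearZ /= => ->. Qed.

Lemma homogeneousM d e f g :
  homogeneous d f -> homogeneous e g -> homogeneous (d (+) e) (f ** g).
Proof. exact: part_smul. Qed.

Lemma part_homogeneous d e f : homogeneous e f -> part d f = if d == e then f else 0.
Proof. by move=> fe; rewrite -[in LHS]fe part_part fe. Qed.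

End SuperAlgebraTheory.

(** * The topology of C^oo(M) *)

Section Reduction.
Variables (R : realType) (M : supermanifold R).
Local Notation A := (Cinfty M).

(** Pointwise facts about [reduced] are all checked through such a chart, where the underlying
    function is the Grassmann coefficient of the empty monomial. *)
Lemma chart_at (x : Defs.space M) :
  exists (p q : nat) (c : superchart M p q) (h : cdom c `<=` opensT (Defs.space M)),
    oset (cdom c) x /\
    forall f : A, forall y, oset (cdom c) y ->
      reduced f y = loc c (restr h f) (cmap c y) finset.set0.
Proof.
have [c cx] := sm_locally_model x.
exists (dim_even M), (dim_odd M), c, (fun _ _ => I); split=> // f y cy.
rewrite -(@loc_reduced _ _ _ _ c (cdom c)) //.
by rewrite reduced_restr.
Qed.

Lemma chart_in (p q : nat) (c : superchart M p q) x : oset (cdom c) x ->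
  (ctgt c `&` cinv c @^-1` cdom c) (cmap c x).
Proof. by move=> cx; have [? e] := cmapK cx; split=> //=; rewrite e. Qed.

Lemma reduced_linear (x : Defs.space M) : linear (fun f : A => (reduced f x : R^o)).
Proof.
move=> a f g; have [p [q [c [h [cx e]]]]] := chart_at x.
rewrite !e //; have [lin _ _ _] := restr_morphism h.
by rewrite lin loc_linear //; exact: chart_in.
Qed.

Lemma reduced_part (d : bool) (f : A) x :
  reduced (part d f) x = if d then 0 else reduced f x.
Proof.
have [p [q [c [h [cx e]]]]] := chart_at x.
rewrite !e //; have [_ _ _ ->] := restr_morphism h.
by rewrite loc_part ?cards0; [case: d|by []|exact: chart_in].
Qed.

(** In a Grassmann product the coefficient at the empty set is a sum with one term, for the empty
    subset, and there are no inversions. *)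
Lemma reducedM (f g : A) x : reduced (f ** g) x = reduced f x * reduced g x.
Proof.
have [p [q [c [h [cx e]]]]] := chart_at x.
rewrite !e //; have [_ _ -> _] := restr_morphism h.
rewrite loc_mul //; last exact: chart_in.
rewrite ffunE (big_pred1 finset.set0); last by move=> S; rewrite /= finset.subset0.
rewrite finset.setD0 /inversions.
rewrite eq_card0 ?expr0 ?mul1r // => ij.
by rewrite !finset.inE.
Qed.

Lemma reduced_continuous (f : A) : continuous (reduced f : Defs.space M -> R).
Proof.
move=> x; have [p [q [c [h [cx e]]]]] := chart_at x.
pose F y : R^o := loc c (restr h f) y finset.set0.
have Fc : {for cmap c x, continuous F}.
  (* Smoothness is used at order 0, where it is just continuity. *)
  have [+ _] := @loc_smooth _ _ _ _ c (cdom c) (@subset_refl _ _) (restr h f) finset.set0 0.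
  by apply; exact: chart_in.
have Fx : F \o cmap c @ x --> reduced f x.
  rewrite (e f x cx); exact: continuous_comp (cmap_continuous cx) Fc.
apply: cvg_trans Fx; apply: near_eq_cvg.
near=> y; rewrite /= /F -e //; near: y.
by apply: open_nbhs_nbhs; split=> //; exact: open_oset.
Unshelve. all: by end_near. Qed.

Lemma reduced_bounded (f : A) (K : set (Defs.space M)) : compact K ->
  exists2 C : R, 0 < C & forall x, K x -> `|reduced f x| <= C.
Proof.
move=> Kc.
have : compact [set (reduced f x : R^o) | x in K].
  apply: continuous_compact => //; apply: continuous_subspaceT.
  exact: reduced_continuous.
(* Every real above [C] is a bound; this one is also positive. *)
move/compact_bounded => [C [_ hC]]; exists (`|C| + 1) => [|x Kx].
  by rewrite ltr_pwDr.
by apply: hC; [rewrite (le_lt_trans (ler_norm C)) // ltrDl|exists x].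
Qed.

(** * Continuity criteria: uniform convergence on compact sets, products, sections *)

Definition compactly_continuous (T : topologicalType)
    (h : T -> Defs.space M -> R) :=
  forall K, compact K -> forall t (e : R), 0 < e ->
    \forall s \near t, forall x, K x -> `|h t x - h s x| < e.

(** The uniform structure of R is generated by balls, so an epsilon estimate on each compact set
    suffices. *)
Lemma continuous_compact_family (T : topologicalType) (h : T -> Defs.space M -> R) :
  continuous (h : T -> {family compact, Defs.space M -> R}) <->
  compactly_continuous h.
Proof.
split=> [hc K Kc t e e0|hu t].
  have /fam_cvgP/(_ _ Kc) := hc t.
  move=> /(_ [set g | forall x, K x -> `|h t x - g x| < e]); apply.
  apply/uniform_nbhs.
  exists [set xy | ball xy.1 e xy.2]; split => //.
  exact: (entourage_ball R (PosNum e0)).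
apply/fam_cvgP => K Kc P /uniform_nbhs [E [entE EP]].
move: entE; rewrite -entourage_ballE => -[e /= e0 eE].
have := hu K Kc t e e0; apply: filterS => s ts.
by apply: EP => x Kx; apply: eE; exact: ts.
Qed.

Lemma continuous_prod_topology (T : topologicalType) (I : Type)
    (K : I -> topologicalType) (u : T -> prod_topology K) :
  continuous u <-> forall i, continuous (fun t => u t i).
Proof.
split=> [uc i t|uc t].
  have /cvg_sup/(_ i) ut := uc t.
  exact: (@continuous_comp T (initial_topology (fun f : prod_topology K => f i))
    _ u (fun f => f i) t ut (@initial_continuous _ _ _ _)).
apply/cvg_sup => i.
exact: (@continuous_comp_initial _ _ _ (fun f : prod_topology K => f i) u).
Qed.

(** This combines the universal properties of the initial topology along [reductions] and of the
    product over all differential operators. *)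
Lemma continuous_Cinfty (T : topologicalType) (u : T -> A) :
  continuous u <->
  forall D, diffop D -> compactly_continuous (fun t => reduced (D (u t))).
Proof.
split=> [uc D dD|hu].
  apply/continuous_compact_family.
  have rc : continuous (@reductions R M : A -> _) by exact: initial_continuous.
  have ruc : continuous (@reductions R M \o u).
    by move=> t; exact: continuous_comp (uc t) (rc _).
  by have /continuous_prod_topology/(_ (exist _ D dD)) := ruc.
apply: (@continuous_comp_initial _ _ _ (@reductions R M)).
apply/continuous_prod_topology => -[D dD].
by apply/continuous_compact_family; exact: hu.
Qed.
End Reduction.

(** * Differential operators and parity *)

Section Diffop.
Variables (R : realType) (M : supermanifold R).
Local Notation A := (Cinfty M).

(** The defining rule asks for a homogeneous first factor; splitting [f] by parity removes this
    restriction. *)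
Lemma vector_field_leibniz e (X : A -> A) (f g : A) : vector_field e X ->
  X (f ** g) = X f ** g + (part false f ** X g + (-1) ^+ e *: (part true f ** X g)).
Proof.
move=> [Xl _ XM].
rewrite -{1}(part_sum f) smulDl (linear_morphD Xl).
rewrite (XM false _ _ (homogeneous_part _ _)) (XM true _ _ (homogeneous_part _ _)).
by rewrite andbF andbT expr0 scale1r addrACA -smulDl -(linear_morphD Xl) part_sum.
Qed.

Lemma diffop_linear (D : A -> A) : diffop D -> linear D.
Proof.
elim=> [h|e X []//|D1 E1 _ h1 _ h2|D1 E1 _ h1 _ h2] a f g.
- exact: linearP.
- by rewrite h1 h2 scalerDr addrACA.
- by rewrite h2 h1.
Qed.

(** Induction on the operator: a multiplication splits with its coefficient, a vector field already
    has a parity, and parities add under composition. *)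
Lemma diffop_parity (D : A -> A) : diffop D ->
  exists D' : bool -> A -> A,
    [/\ forall e, diffop (D' e), forall f, D f = D' false f + D' true f &
        forall e d f, homogeneous d f -> homogeneous (e (+) d) (D' e f)].
Proof.
have diffop0 : diffop (fun _ : A => 0 : A).
  have -> : (fun=> 0) = smul (0 : A) by apply/funext => f; rewrite smul0l.
  exact: diffop_mul.
elim=> [h|e X vX|D1 E1 _ [D' [dD sD hD]] _ [E' [dE sE hE]]
  |D1 E1 _ [D' [dD sD hD]] _ [E' [dE sE hE]]].
- exists (fun e f => part e h ** f); split=> [e|f|e d f fd].
  + exact: diffop_mul.
  + by rewrite -smulDl part_sum.
  + by apply: homogeneousM => //; exact: homogeneous_part.
- exists (fun d => if d == e then X else fun=> 0); split=> [d|f|d d' f fd].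
  + case: eqP => _ /=; first exact: (diffop_vf vX).
    exact: diffop0.
  + by case: e vX => _; rewrite /= (addr0, add0r).
  + case: eqP => [->|_] /=; first by case: vX => _ + _; apply.
    by rewrite /homogeneous raddf0.
- exists (fun e f => D' e f + E' e f); split=> [e|f|e d f fd].
  + exact: diffop_add.
  + by rewrite sD sE addrACA.
  + by apply: homogeneousD; [exact: hD|exact: hE].
- exists (fun e f => D' false (E' e f) + D' true (E' (~~ e) f)); split=> [e|f|e d f fd].
  + by apply: diffop_add; exact: diffop_comp.
  + have aD b := linear_morphD (diffop_linear (dD b)).
    by rewrite sD sE /= !aD [X in _ + X = _]addrC addrACA.
  + apply: homogeneousD; first by have := hD false _ _ (hE e _ _ fd).
    by have := hD true _ _ (hE (~~ e) _ _ fd); rewrite addbA addTb negbK.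
Qed.

(* [reduced] kills odd sections, so only the component of [D] of parity [e] survives. *)
Lemma diffop_reduced_part (D : A -> A) e : diffop D ->
  exists2 D', diffop D' & forall f x, reduced (D (part e f)) x = reduced (D' f) x.
Proof.
move=> /diffop_parity [D' [dD sD hD]]; exists (D' e) => // f x.
have redD := linear_morphD (reduced_linear x).
have odd0 (u : A) : homogeneous true u -> reduced u x = 0.
  by move=> <-; rewrite reduced_part.
have aD b := linear_morphD (diffop_linear (dD b)).
have odd_part b : reduced (D' b (part (~~ b) f)) x = 0.
  apply: odd0; have := hD b _ _ (homogeneous_part (~~ b) f).
  by rewrite addbN addbb.
rewrite sD redD -[in RHS](part_sum f) aD redD.
by case: e; rewrite ?(odd_part false) ?(odd_part true) ?addr0 ?add0r.
Qed.

(** * Continuity of the algebra operations *)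

Section Continuity.
Variable T : topologicalType.
Implicit Types u v w : T -> A.

Lemma continuous_diffop D u : diffop D -> continuous u -> continuous (D \o u).
Proof.
move=> dD /continuous_Cinfty uc; apply/continuous_Cinfty => E dE.
exact: (uc _ (diffop_comp dE dD)).
Qed.

(** Testing a component of [u] against [D] amounts to testing [u] itself against one homogeneous
    component of [D]. *)
Lemma continuous_part e u : continuous u -> continuous (part e \o u).
Proof.
move=> /continuous_Cinfty uc; apply/continuous_Cinfty => D dD.
have [D' dD' eD] := diffop_reduced_part e dD.
have -> : (fun t => reduced (D ((part e \o u) t))) = (fun t => reduced (D' (u t))).
  by apply/funext => t; apply/funext => x; exact: eD.
exact: uc.
Qed.

Lemma compactly_continuousD (h k : T -> Defs.space M -> R) :
  compactly_continuous h -> compactly_continuous k ->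
  compactly_continuous (fun t x => h t x + k t x).
Proof.
move=> hu ku K Kc t e e0; have e2 : 0 < e / 2 by rewrite divr_gt0.
near=> s => x Kx; rewrite opprD addrACA.
rewrite (le_lt_trans (ler_normD _ _)) // [e]splitr ltrD //.
- by move: x Kx; near: s; exact: hu.
- by move: x Kx; near: s; exact: ku.
Unshelve. all: by end_near. Qed.

Lemma continuousD_Cinfty u v :
  continuous u -> continuous v -> continuous (fun t => u t + v t).
Proof.
move=> /continuous_Cinfty uc /continuous_Cinfty vc; apply/continuous_Cinfty => D dD.
have -> : (fun t => reduced (D (u t + v t))) =
          (fun t x => reduced (D (u t)) x + reduced (D (v t)) x).
  apply/funext => t; apply/funext => x.
  by rewrite (linear_morphD (diffop_linear dD)) (linear_morphD (reduced_linear x)).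
by apply: compactly_continuousD; [exact: uc|exact: vc].
Qed.

Lemma continuousZ_Cinfty (a : R) u : continuous u -> continuous (fun t => a *: u t).
Proof.
(* Scaling is multiplication by a constant section, hence a differential operator. *)
move=> uc; have -> : (fun t => a *: u t) = smul (a *: sone) \o u.
  by apply/funext => t; rewrite /= smulZl smul1l.
by apply: continuous_diffop uc; exact: diffop_mul.
Qed.

(* By the Leibniz rule, this class is stable under differential operators. *)
Inductive product_sum : (T -> A) -> Prop :=
| product_sumM u v : continuous u -> continuous v -> product_sum (fun t => u t ** v t)
| product_sumD w w' : product_sum w -> product_sum w' ->
    product_sum (fun t => w t + w' t).

Lemma product_sum_diffop D w : diffop D -> product_sum w -> product_sum (D \o w).
Proof.
move=> dD; elim: dD w => {D} [h|e X vX|D E dD hD dE hE|D E dD hD dE hE] w.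
- elim=> [u v uc vc|u v _ hu _ hv].
    have -> : smul h \o (fun t => u t ** v t) = (fun t => (smul h \o u) t ** v t).
      by apply/funext => t; rewrite /= smulA.
    by apply: product_sumM => //; apply: continuous_diffop uc; exact: diffop_mul.
  have -> : smul h \o (fun t => u t + v t) = (fun t => (smul h \o u) t + (smul h \o v) t).
    by apply/funext => t; rewrite /= smulDr.
  exact: product_sumD.
- have dX : diffop X by exact: diffop_vf vX.
  elim=> [u v uc vc|u v _ hu _ hv].
    (* The sign is absorbed into the left factor, so that each summand is a plain product of
       continuous maps. *)
    have -> : X \o (fun t => u t ** v t) = (fun t => (X \o u) t ** v t +
        ((part false \o u) t ** (X \o v) t +
         (-1) ^+ e *: (part true \o u) t ** (X \o v) t)).
      by apply/funext => t; rewrite /= (vector_field_leibniz _ _ vX) smulZl.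
    have pc b : continuous (part b \o u) by exact: continuous_part.
    have Xc w' : continuous w' -> continuous (X \o w') by exact: continuous_diffop.
    apply: product_sumD; first by apply: product_sumM => //; exact: Xc.
    apply: product_sumD; apply: product_sumM; by [exact: Xc|exact: continuousZ_Cinfty|].
  have -> : X \o (fun t => u t + v t) = (fun t => (X \o u) t + (X \o v) t).
    by apply/funext => t; rewrite /= (linear_morphD (diffop_linear dX)).
  exact: product_sumD.
- by move=> pw; apply: product_sumD; [exact: hD|exact: hE].
- by move=> pw; apply: (hD (E \o w)); exact: hE.
Qed.

Lemma reduced_product_sum w : product_sum w ->
  compactly_continuous (fun t => reduced (w t)).
Proof.
elim=> [u v /continuous_Cinfty uc /continuous_Cinfty vc|u v _ hu _ hv]; last first.
  have -> : (fun t => reduced (u t + v t)) = (fun t x => reduced (u t) x + reduced (v t) x).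
    apply/funext => t; apply/funext => x.
    by rewrite (linear_morphD (reduced_linear x)).
  exact: compactly_continuousD.
have did : diffop (@idfun A).
  have -> : @idfun A = smul sone by apply/funext => f; rewrite smul1l.
  exact: diffop_mul.
have {}uc := uc _ did; have {}vc := vc _ did.
move=> K Kc t e e0.
(* [C] bounds [u t] and [B] bounds [v t] on [K]; near [t] the factor [v s] is then bounded by
   [B + 1]. With these tolerances each of the two terms of the difference of products contributes at
   most [e / 2]. *)
have [C C0 hC] := reduced_bounded (u t) Kc.
have [B B0 hB] := reduced_bounded (v t) Kc.
have B10 : 0 < B + 1 by rewrite addr_gt0.
near=> s.
have hus : forall x, K x -> `|reduced (u t) x - reduced (u s) x| < e / 2 / (B + 1).
  by near: s; apply: (uc K Kc t); rewrite !divr_gt0.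
have hvs : forall x, K x -> `|reduced (v t) x - reduced (v s) x| < e / 2 / C.
  by near: s; apply: (vc K Kc t); rewrite !divr_gt0.
have hv1 : forall x, K x -> `|reduced (v t) x - reduced (v s) x| < 1.
  by near: s; exact: (vc K Kc t).
move=> x Kx; rewrite !reducedM.
have {}hus := hus x Kx; have {}hvs := hvs x Kx; have {}hv1 := hv1 x Kx.
have hv : `|reduced (v s) x| <= B + 1.
  rewrite -[reduced (v s) x](subKr (reduced (v t) x)).
  by rewrite (le_trans (ler_normB _ _)) // lerD ?hB // ltW.
have -> : reduced (u t) x * reduced (v t) x - reduced (u s) x * reduced (v s) x =
    reduced (u t) x * (reduced (v t) x - reduced (v s) x) +
    (reduced (u t) x - reduced (u s) x) * reduced (v s) x by ring.
rewrite (le_lt_trans (ler_normD _ _)) // !normrM [e]splitr ltr_leD //.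
- rewrite (le_lt_trans (ler_wpM2r _ (hC x Kx))) //.
  by rewrite mulrC -ltr_pdivlMr.
- rewrite (le_trans (ler_wpM2l _ hv)) //.
  by rewrite -ler_pdivlMr // ltW.
Unshelve. all: by end_near. Qed.

Lemma continuousM_Cinfty u v :
  continuous u -> continuous v -> continuous (fun t => u t ** v t).
Proof.
move=> uc vc; apply/continuous_Cinfty => D dD.
by apply: (@reduced_product_sum (D \o _)); apply: product_sum_diffop => //; exact: product_sumM.
Qed.

End Continuity.
End Diffop.

(** * Cochains *)

Section ZeroCochains.
Variables (R : realType) (M : qManifold R).
Local Notation A := (Cinfty M).

Lemma cochain0E (sigma : ('I_1 -> A) -> R^o) f : sigma f = sigma (fun=> f ord0).
Proof. by congr sigma; apply/funext => i; rewrite ord1. Qed.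

Lemma cochain0_linear (sigma : ('I_1 -> A) -> R^o) :
  is_cochain sigma -> linear (fun x => sigma (fun=> x)).
Proof.
move=> [lin _] a f g; have := lin (fun=> 0) ord0 a f g.
have constE x : dfwith (fun=> 0 : A) ord0 x = (fun=> x) :> ('I_1 -> A).
  by apply/funext => i; rewrite (ord1 i) dfwithin.
by rewrite !constE.
Qed.

Lemma derived_product_linearl (D : A -> A) (g : A) :
  linear D -> linear ((derived_product D)^~ g).
Proof.
move=> Dl a f f'; rewrite /derived_product scaler_sumr -big_split.
apply: eq_bigr => e _ /=.
by rewrite linearP Dl smul_linearl scalerDr !scalerA mulrC.
Qed.

Lemma derived_product_linearr (D : A -> A) (f : A) : linear (derived_product D f).
Proof.
move=> a g g'; rewrite /derived_product scaler_sumr -big_split.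
by apply: eq_bigr => e _ /=; rewrite smul_linearr scalerDr !scalerA mulrC.
Qed.

Lemma derived_product_homogeneous (D : A -> A) d (f g : A) : linear D ->
  homogeneous d f -> derived_product D f g = (-1) ^+ d *: (D f ** g).
Proof.
move=> Dl fd; rewrite /derived_product (bigD1 d) //= fd big1 ?addr0 // => e ed.
by rewrite (part_homogeneous _ fd) (negPf ed) (linear_morph0 Dl) smul0l scaler0.
Qed.

(** The section to which [tau] is applied in [symmetry_cochain], isolated so that bilinearity can be
    used before [tau]. *)
Definition symmetry_product (X : A -> A) (f g : A) : A :=
  \sum_(e : bool) (-1) ^+ e *: X (part e f ** g).

Lemma symmetry_product_linearl (X : A -> A) (g : A) :
  linear X -> linear ((symmetry_product X)^~ g).
Proof.
move=> Xl a f f'; rewrite /symmetry_product scaler_sumr -big_split.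
apply: eq_bigr => e _ /=.
by rewrite linearP smul_linearl Xl scalerDr !scalerA mulrC.
Qed.

Lemma symmetry_product_linearr (X : A -> A) (f : A) :
  linear X -> linear (symmetry_product X f).
Proof.
move=> Xl a g g'; rewrite /symmetry_product scaler_sumr -big_split.
by apply: eq_bigr => e _ /=; rewrite smul_linearr Xl scalerDr !scalerA mulrC.
Qed.

Lemma symmetry_product_homogeneous (X : A -> A) d (f g : A) : linear X ->
  homogeneous d f -> symmetry_product X f g = (-1) ^+ d *: X (f ** g).
Proof.
move=> Xl fd; rewrite /symmetry_product (bigD1 d) //= fd big1 ?addr0 // => e ed.
by rewrite (part_homogeneous _ fd) (negPf ed) smul0l (linear_morph0 Xl) scaler0.
Qed.

(** Reduces bilinear identities to homogeneous arguments, where the sign rules apply and four parity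
    cases remain. *)
Lemma bilinear_parts (W : lmodType R) (B : A -> A -> W) (f g : A) :
  (forall g, linear (B^~ g)) -> (forall f, linear (B f)) ->
  B f g = \sum_a \sum_b B (part a f) (part b g).
Proof.
move=> Bl Br; rewrite !big_bool /= -!(linear_morphD (Br _)).
by rewrite -(linear_morphD (Bl _)) [_ + part false f]addrC [_ + part false g]addrC !part_sum.
Qed.

(** * Cyclic signs in low degree and the coboundary of a 0-cochain *)

Lemma cyclic_exponent2 (p : {ffun 'I_2 -> bool}) :
  cyclic_exponent p = (~~ p ord_max * ~~ p ord0)%N.
Proof. by rewrite /cyclic_exponent big_mkcond !big_ord_recl big_ord0 /= !addn0. Qed.

Lemma cyclic_exponent3 (p : {ffun 'I_3 -> bool}) :
  cyclic_exponent p = (~~ p ord_max * (~~ p ord0 + ~~ p (lift ord0 ord0)))%N.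
Proof. by rewrite /cyclic_exponent big_mkcond !big_ord_recl big_ord0 /= !addn0. Qed.

Lemma face1 (B : Type) (m : A -> A -> B) (inj : A -> B) (f : 'I_2 -> A) :
  face m inj f ord0 = fun=> m (f ord0) (f ord_max).
Proof.
apply/funext => j; rewrite (ord1 j) /face /=.
by congr (m (f _) (f _)); exact: val_inj.
Qed.

Lemma last_face1 (B : Type) (m : A -> A -> B) (inj : A -> B) (f : 'I_2 -> A) :
  last_face m inj f = fun=> m (f ord_max) (f ord0).
Proof. by apply/funext => j; rewrite (ord1 j). Qed.

Lemma hochschild0 (B : Type) (W : lmodType R) (m : A -> A -> B) (inj : A -> B)
    (phi : ('I_1 -> B) -> W) (f : 'I_2 -> A) :
  hochschild m inj phi f = phi (fun=> m (f ord0) (f ord_max)) +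
    \sum_a \sum_b (-1) ^+ (1 + ~~ b * ~~ a) *:
      phi (fun=> m (part b (f ord_max)) (part a (f ord0))).
Proof.
rewrite /hochschild big_ord1 expr0 scale1r face1; congr (_ + _).
rewrite -(sum_ffun2 (fun a b => (-1) ^+ (1 + ~~ b * ~~ a) *:
  phi (fun=> m (part b (f ord_max)) (part a (f ord0))))).
by apply: eq_bigr => p _; rewrite cyclic_exponent2 last_face1.
Qed.

(* both sides are (-1)^f0 sigma(D(f0) f1 + (-1)^f0 f0 D(f1)) on homogeneous arguments *)
Lemma hochschild_derived_product (D : A -> A) (sigma : ('I_1 -> A) -> R^o) :
  vector_field true D -> is_cochain sigma ->
  hochschild (derived_product D) id sigma = symmetry_cochain D sigma.
Proof.
move=> [Dl Dh DM] csigma; apply/funext => f.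
pose s x := sigma (fun=> x); have sl : linear s := cochain0_linear csigma.
rewrite hochschild0 -[RHS]/(s (symmetry_product D (f ord0) (f ord_max))).
rewrite -[LHS]/(s (derived_product D (f ord0) (f ord_max)) +
  \sum_a \sum_b (-1) ^+ (1 + ~~ b * ~~ a) *:
    s (derived_product D (part b (f ord_max)) (part a (f ord0)))).
clearbody s.
rewrite (bilinear_parts _ _ (fun g => derived_product_linearl g Dl)
  (derived_product_linearr D)).
rewrite (bilinear_parts _ _ (fun g => symmetry_product_linearl g Dl)
  (fun f => symmetry_product_linearr f Dl)).
rewrite !(linear_morph_sum sl) -big_split; apply: eq_bigr => a _ /=.
rewrite !(linear_morph_sum sl) -big_split; apply: eq_bigr => b _ /=.
have xa := homogeneous_part a (f ord0); have yb := homogeneous_part b (f ord_max).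
move: (part a _) (part b _) xa yb => x y xa yb.
rewrite (derived_product_homogeneous _ Dl xa) (derived_product_homogeneous _ Dl yb).
rewrite (symmetry_product_homogeneous _ Dl xa) !(linear_morphZ sl).
rewrite (DM a) // (linear_morphD sl) (linear_morphZ sl).
(* Moving [D y] to the front gives the product that occurs in the cyclic term; only the signs remain
   to be compared. *)
rewrite [x ** D y](supercomm _ _ _ _ xa (Dh _ _ yb)) (linear_morphZ sl).
move: (s _) (s _) => u v; case: a b {xa yb} => -[] /=.
all: rewrite ?mul0n ?mul1n ?addn0 ?expr0 ?expr1 ?sqrrN ?expr1n ?scaleN1r ?scale1r.
all: by rewrite ?scalerDr ?scaleN1r ?scale1r ?opprD ?opprK.
Qed.

(** * The symmetry cochain: multilinearity, cyclicity, closedness *)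

Section SymmetryCochain.
Variables (X : A -> A) (tau : ('I_1 -> A) -> R^o).
Hypotheses (Xvf : vector_field true X) (ctau : is_cochain tau).

Let Xl : linear X. Proof. by have [] := Xvf. Qed.

Let tl : linear (fun x => tau (fun=> x)). Proof. exact: cochain0_linear. Qed.

Lemma symmetry_cochain_multilinear (f : 'I_2 -> A) i (a : R) (u v : A) :
  symmetry_cochain X tau (dfwith f i (a *: u + v)) =
  a * symmetry_cochain X tau (dfwith f i u) + symmetry_cochain X tau (dfwith f i v).
Proof.
have symE g : symmetry_cochain X tau g =
  tau (fun=> symmetry_product X (g ord0) (g ord_max)) by [].
rewrite !symE; have /orP[/eqP ->|/eqP ->] : (i == ord0) || (i == ord_max).
  by case: i => -[|[|]].
- by rewrite !dfwithin !dfwithout // symmetry_product_linearl // tl.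
- by rewrite !dfwithin !dfwithout // symmetry_product_linearr // tl.
Qed.

(** [X] is applied to the product of the arguments, and these supercommute. For parities a and b,
    the exchange sign (-1)^(ab), the cyclic sign (-1)^(1 + (a+1)(b+1)) and the sign (-1)^b multiply
    to (-1)^a. *)
Lemma symmetry_cochain_cyclic : lam (symmetry_cochain X tau) = symmetry_cochain X tau.
Proof.
apply/funext => f; pose s x := tau (fun=> x); have sl : linear s := tl.
rewrite /lam; under eq_bigr => p _.
  rewrite cyclic_exponent2.
  rewrite -[symmetry_cochain _ _ _]/(s (symmetry_product X (parts p f (ord_pred ord0))
    (parts p f (ord_pred ord_max)))).
  have -> : ord_pred (ord0 : 'I_2) = ord_max by exact: val_inj.
  have -> : ord_pred (ord_max : 'I_2) = ord0 by exact: val_inj.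
  over.
rewrite -[RHS]/(s (symmetry_product X (f ord0) (f ord_max))).
clearbody s.
rewrite (sum_ffun2 (fun a b => (-1) ^+ (1 + ~~ b * ~~ a) *:
  s (symmetry_product X (part b (f ord_max)) (part a (f ord0))))).
rewrite (bilinear_parts (f ord0) _ (fun g => symmetry_product_linearl g Xl)
  (fun f => symmetry_product_linearr f Xl)).
rewrite !(linear_morph_sum sl); apply: eq_bigr => a _ /=.
rewrite !(linear_morph_sum sl); apply: eq_bigr => b _ /=.
have xa := homogeneous_part a (f ord0); have yb := homogeneous_part b (f ord_max).
move: (part a _) (part b _) xa yb => x y xa yb.
rewrite (symmetry_product_homogeneous _ Xl xa) (symmetry_product_homogeneous _ Xl yb).
rewrite (supercomm _ _ _ _ yb xa) (linear_morphZ Xl) !(linear_morphZ sl).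
move: (s _) => u; case: a b {xa yb} => -[] /=.
all: rewrite ?mul0n ?mul1n ?addn0 ?expr0 ?expr1 ?sqrrN ?expr1n ?scaleN1r ?scale1r.
all: by rewrite ?scaleN1r ?scale1r ?opprK.
Qed.

(* On homogeneous arguments each of the three terms of [b phi] is, up to the common
   sign (-1)^(f1 + 1), one term of the Leibniz expansion of [tau (X (Q (f0 f1 f2)))]. *)
Lemma symmetry_cochain_closed (Q : A -> A) : vector_field true Q ->
  (forall f, tau (fun=> X (Q f)) = 0) ->
  hochschild (derived_product Q) id (symmetry_cochain X tau) = 0.
Proof.
move=> [Ql Qh QM] tXQ; apply/funext => f; rewrite [RHS]/(0 : R^o).
pose s x := tau (fun=> x); have sl : linear s := tl.
pose m := derived_product Q; pose n := symmetry_product X.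
pose o1 : 'I_3 := lift ord0 ord0.
have -> : hochschild m id (symmetry_cochain X tau) f =
    s (n (m (f ord0) (f o1)) (f ord_max)) - s (n (f ord0) (m (f o1) (f ord_max))) +
    \sum_a \sum_b \sum_c (-1) ^+ (2 + ~~ c * (~~ a + ~~ b)) *:
      s (n (m (part c (f ord_max)) (part a (f ord0))) (part b (f o1))).
  rewrite /hochschild big_ord_recl big_ord1; congr (_ + _).
    rewrite expr0 scale1r expr1 scaleN1r; congr (_ - _).
      rewrite -[LHS]/(s (n _ _)) /face /=.
      by congr (s (n (m (f _) (f _)) (f _))); exact: val_inj.
    rewrite -[LHS]/(s (n _ _)) /face /=.
    by congr (s (n (f _) (m (f _) (f _)))); exact: val_inj.
  rewrite -(sum_ffun3 (fun a b c => (-1) ^+ (2 + ~~ c * (~~ a + ~~ b)) *: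
    s (n (m (part c (f ord_max)) (part a (f ord0))) (part b (f o1))))).
  apply: eq_bigr => p _; rewrite cyclic_exponent3; congr (_ *: _).
  rewrite -[LHS]/(s (n _ _)) /last_face /=.
  by congr (s (n _ (part (p _) (f _)))); exact: val_inj.
have sXQ g : s (X (Q g)) = 0 by exact: tXQ.
clearbody s.
(* The cyclic term is already a sum over parities; the two face terms are expanded likewise, so that
   the cancellation happens parity by parity. *)
have trilinear (T : A -> A -> A -> R^o) :
    (forall y z, linear (fun x => T x y z)) -> (forall x z, linear (fun y => T x y z)) ->
    (forall x y, linear (T x y)) -> forall x y z,
    T x y z = \sum_a \sum_b \sum_c T (part a x) (part b y) (part c z).
  move=> Tx Ty Tz x y z; rewrite (bilinear_parts _ _ (Tx ^~ z) (Ty ^~ z)).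
  apply: eq_bigr => a _; apply: eq_bigr => b _.
  by rewrite -[in LHS](part_sum z) (linear_morphD (Tz _ _)) big_bool addrC.
have ml g : linear (m^~ g) by exact: derived_product_linearl.
have mr g : linear (m g) by exact: derived_product_linearr.
have nl g : linear (n^~ g) by exact: symmetry_product_linearl.
have nr g : linear (n g) by exact: symmetry_product_linearr.
rewrite (trilinear (fun x y z => s (n (m x y) z) - s (n x (m y z)))); last first.
- by move=> x y k u v; rewrite !(nr, mr, sl) opprD addrACA scalerBr.
- by move=> x z k u v; rewrite !(ml, mr, nl, nr, sl) opprD addrACA scalerBr.
- by move=> y z k u v; rewrite !(ml, nl, sl) opprD addrACA scalerBr.
rewrite -big_split big1 // => a _; rewrite -big_split big1 // => b _.
rewrite -big_split big1 // => c _ /=.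
have xa := homogeneous_part a (f ord0); have yb := homogeneous_part b (f o1).
have zc := homogeneous_part c (f ord_max).
move: (part a _) (part b _) (part c _) xa yb zc => x y z xa yb zc.
have mxy := homogeneousZ ((-1) ^+ a) (homogeneousM (Qh _ _ xa) yb).
have mzx := homogeneousZ ((-1) ^+ c) (homogeneousM (Qh _ _ zc) xa).
rewrite /n /m !(derived_product_homogeneous _ Ql xa, derived_product_homogeneous _ Ql yb,
  derived_product_homogeneous _ Ql zc).
rewrite (symmetry_product_homogeneous _ Xl mxy) (symmetry_product_homogeneous _ Xl xa).
rewrite (symmetry_product_homogeneous _ Xl mzx) smulZr !smulZl.
(* [Q z] moves behind [x ** y], its place in the Leibniz expansion of [Q (x ** y ** z)]. *)
rewrite -[Q z ** x ** y]smulA (supercomm _ _ _ _ (Qh _ _ zc) (homogeneousM xa yb)).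
have := sXQ (x ** y ** z).
rewrite (QM _ _ _ (homogeneousM xa yb)) (QM _ _ _ xa) smulDl smulZl.
rewrite smulA !(linear_morphD Xl, linear_morphZ Xl) !(linear_morphD sl, linear_morphZ sl).
move: (s _) (s _) (s _) => u v w; case: a b c {xa yb zc mxy mzx} => -[] [] /=.
all: rewrite ?mul0n ?mul1n ?addn0 ?expr0 ?expr1 ?sqrrN ?expr1n ?scaleN1r ?scale1r.
all: rewrite ?add0n ?exprD ?expr1 ?sqrrN ?expr1n ?mul1r ?mulN1r ?opprK ?scale1r ?scaleN1r.
all: rewrite ?mulr1 ?scale1r ?opprD ?opprK.
(* Depending on the common sign, the goal is [h] or its opposite. *)
all: move=> h; first [exact: h|by apply: oppr_inj; rewrite oppr0 -[RHS]h !opprD ?opprK].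
Qed.

End SymmetryCochain.
End ZeroCochains.

(** * Continuity of the symmetry cochain and the deformation criterion *)

Lemma symmetry_cochain_continuous (R : realType) (M : qManifold R)
    (X : Cinfty M -> Cinfty M) (tau : ('I_1 -> Cinfty M) -> R^o) :
  vector_field true X -> is_cochain tau ->
  continuous (symmetry_cochain X tau :
    prod_topology (fun _ : 'I_2 => Cinfty M) -> R^o).
Proof.
move=> Xvf [_ tc] f; pose T : topologicalType := prod_topology (fun _ : 'I_2 => Cinfty M).
pose w (g : T) := symmetry_product X (g ord0) (g ord_max).
have projc (i : 'I_2) : continuous (fun g : T => g i) by exact: proj_continuous.
have wc : continuous w.
  have termc (e : bool) : continuous (fun g : T =>
      (-1) ^+ e *: X (part e (g ord0) ** g ord_max)).
    apply: continuousZ_Cinfty; apply: continuous_diffop; first exact: diffop_vf Xvf.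
    apply: continuousM_Cinfty; last exact: projc.
    exact: (continuous_part (projc ord0)).
  have -> : w = fun g => (-1) ^+ true *: X (part true (g ord0) ** g ord_max) +
                         (-1) ^+ false *: X (part false (g ord0) ** g ord_max).
    by apply/funext => g; rewrite /w /symmetry_product big_bool.
  by apply: continuousD_Cinfty; exact: termc.
(* [tau] is continuous on the product over a one-element index set, so [w] is first lifted to
   constant families. *)
pose S : topologicalType := prod_topology (fun _ : 'I_1 => Cinfty M).
have cc : continuous ((fun g => fun=> w g) : T -> S).
  by apply/continuous_prod_topology => i.
exact: (@continuous_comp T S _ (fun g => fun=> w g) tau f (cc f) (tc _)).
Qed.

Lemma symmetry_cochain_cocycle (R : realType) (M : qManifold R)
    (X : Cinfty M -> Cinfty M) (tau : ('I_1 -> Cinfty M) -> R^o) :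
  odd_symmetry X -> tau \in @cyclic_cocycle R M 0 ->
  symmetry_cochain X tau \in @cyclic_cocycle R M 1.
Proof.
move=> [Xvf QX] /asboolP[[ctau _] btau]; apply/asboolP; split; [split; first split|].
- exact: symmetry_cochain_multilinear.
- exact: symmetry_cochain_continuous.
- exact: symmetry_cochain_cyclic.
apply: symmetry_cochain_closed => // [|f]; first exact: Qfield_odd.
have tl := cochain0_linear ctau.
have tauQ g : tau (fun=> @Qfield R M g) = 0.
  have [Ql _ _] := @Qfield_odd R M.
  (* At the pair [(sone, g)] the coboundary of [tau] takes the value of [tau] on [Q g], since [sone]
     is even. *)
  have := congr1 (fun b => b (fun i => if i == ord0 then sone else g)) btau.
  rewrite /coboundary (hochschild_derived_product (Qfield_odd M)) //.
  rewrite -[LHS]/(tau (fun=> symmetry_product _ sone g)).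
  rewrite (@symmetry_product_homogeneous _ _ _ false) //; last exact: part_one.
  by rewrite expr0 scale1r smul1l.
(* For two odd fields the supercommutator is QX + XQ, and [tau] kills the first term. *)
have := congr1 (fun Y => Y f) QX.
rewrite /supercommutator expr1 scaleN1r opprK => /(congr1 (fun x => tau (fun=> x))).
by rewrite (linear_morphD tl) tauQ add0r => ->; exact: (linear_morph0 tl).
Qed.

(** On a single argument x + t y the cochain takes the value tau(x) + t (sigma(x) + tau(y)). Here x
    is a product for Q and y the corresponding product for X, so the orders in t separate in each
    term. *)
Lemma deformed_coboundary0 (R : realType) (M : qManifold R)
    (X : Cinfty M -> Cinfty M) (tau sigma : ('I_1 -> Cinfty M) -> R^o) f :
  deformed_coboundary X tau sigma f =
  (coboundary tau f, coboundary sigma f + hochschild (derived_product X) id tau f).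
Proof.
have first_orderE (x y : Cinfty M) :
    first_order_cochain tau sigma (fun=> (x, y)) =
    (tau (fun=> x), sigma (fun=> x) + tau (fun=> y)).
  rewrite /first_order_cochain big_ord1; congr (_, _ + _).
  by rewrite cochain0E dfwithin.
have sumE (u v : bool -> R^o) :
    \sum_a ((u a, v a) : R^o * R^o) = (\sum_a u a, \sum_a v a).
  by rewrite !big_bool.
rewrite /deformed_coboundary /coboundary !hochschild0 first_orderE.
rewrite [in RHS]addrACA -big_split -[RHS]/((_, _) + (_, _)) -sumE; congr (_ + _).
apply: eq_bigr => a _; rewrite -big_split -sumE; apply: eq_bigr => b _.
by rewrite first_orderE /= -scalerDr.
Qed.

Theorem theorem3p3 (R : realType) (M : qManifold R)
    (X : Cinfty M -> Cinfty M) (hX : odd_symmetry X)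
    (tau : ('I_1 -> Cinfty M) -> R^o) (htau : tau \in @cyclic_cocycle R M 0) :
  exists hphi : symmetry_cochain X tau \in @cyclic_cocycle R M 1,
    (exists sigma : ('I_1 -> Cinfty M) -> R^o,
       is_cyclic_cochain sigma /\ deformed_coboundary X tau sigma = 0)
    <-> HC_class hphi = 0.
Proof.
have hphi := symmetry_cochain_cocycle hX htau; exists hphi.
have [[ctau _] btau] := asboolP _ htau; have [Xvf _] := hX.
have classE : HC_class hphi = 0 <-> is_cyclic_coboundary (symmetry_cochain X tau).
  (* Zero is the class of the zero cocycle, so equality of classes becomes membership of the
     difference in the coboundaries. *)
  have <- : \pi_(Quotient.quot (@cyclic_coboundary R M 1))%qT 0 = 0 by exact: pi_zeror.
  by rewrite (rwP eqP) -Quotient.idealrBE subr0; split=> [/asboolP//|h]; exact/asboolP.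
rewrite classE; have bX := hochschild_derived_product Xvf ctau.
have oppE (psi : ('I_1 -> Cinfty M) -> R^o) : coboundary (0 - psi) = - coboundary psi.
  have b0 : coboundary (0 : ('I_1 -> Cinfty M) -> R^o) = 0.
    by rewrite -(subrr 0) /coboundary hochschildB subrr.
  by rewrite /coboundary hochschildB -/(coboundary 0) b0 sub0r.
have cyclicN (psi : ('I_1 -> Cinfty M) -> R^o) :
  is_cyclic_cochain psi -> is_cyclic_cochain (0 - psi).
  by move=> cpsi; apply: is_cyclic_cochainB => //; exact: is_cyclic_cochain0.
split=> [[sigma [csigma dsigma]]|[psi cpsi phiE]].
  exists (0 - sigma); first exact: cyclicN.
  (* The coefficient of t says that [coboundary sigma] and the symmetry cochain add up to zero. *)
  apply/funext => f; have := congr1 (fun g => (g f).2) dsigma.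
  by rewrite deformed_coboundary0 bX oppE addrC => /eqP; rewrite addr_eq0 => /eqP.
(* With this choice the constant term vanishes because [tau] is closed, and the coefficient of t is
   [- coboundary psi + coboundary psi]. *)
exists (0 - psi); split; first exact: cyclicN.
apply/funext => f; rewrite deformed_coboundary0 bX btau oppE phiE.
by congr (_, _); exact: addNr.
Qed.
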